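(* Let $n\ge 2$ be an integer. Put $S_n=\sum_{l=1}^{n-1}\csc\frac{\pi l}{n}$ and, for $\nu\in\{1,\ldots,n-1\}$, $C_n(\nu)=\sum_{l=1}^{n-1}\cos\frac{2\pi\nu l}{n}\csc\frac{\pi l}{n}$. Then $$\sum_{\nu=1}^{n-1}\Psi\!\left(\frac{\nu}{n}\right)\csc\frac{\pi\nu}{n}=-(\gamma+\ln 2n)\,S_n-\sum_{\nu=1}^{n-1}C_n(\nu)\ln\csc\frac{\pi\nu}{n}.$$
   Context: $\Psi=\Gamma'/\Gamma$ is the digamma function and $\gamma$ is Euler's constant; $\ln 2n$ means $\ln(2n)$. *)

(* Defs.v *)
From mathcomp Require Import all_boot all_order all_algebra.
From mathcomp Require Import all_classical all_reals all_analysis.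

Set Implicit Arguments.
Unset Strict Implicit.
Unset Printing Implicit Defensive.

Import Order.TTheory GRing.Theory Num.Theory.
Import numFieldNormedType.Exports.

Local Open Scope classical_set_scope.
Local Open Scope ring_scope.

(* Euler's integral of the second kind. It represents the Gamma function for
   0 < x, the only range used here; for x <= 0 the integral diverges and
   [Rintegral] returns a junk value. *)
Definition Gamma {R : realType} (x : R) : R :=
  \int[lebesgue_measure]_(t in `]0, +oo[) (t `^ (x - 1) * expR (- t)).

Definition digamma {R : realType} (x : R) : R := derive1 (@Gamma R) x / Gamma x.

(* [series harmonic m] is 1 + 1/2 + ... + 1/m. *)
Definition euler_gamma {R : realType} : R :=
  lim ((series harmonic m - ln (m%:R : R)) @[m --> \oo]).

Definition csc {R : realType} (x : R) : R := (sin x)^-1.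

Definition csc_sum (R : realType) (n : nat) : R :=
  \sum_(1 <= l < n) csc (pi * l%:R / n%:R).

Definition cos_csc_sum (R : realType) (n nu : nat) : R :=
  \sum_(1 <= l < n)
    cos (2 * pi * nu%:R * l%:R / n%:R) * csc (pi * l%:R / n%:R).

(* Main.v *)
Require Import Defs.
From mathcomp Require Import all_boot all_order all_algebra.
From mathcomp Require Import all_classical all_reals all_analysis.
From mathcomp Require Import measurable_realfun.
From mathcomp Require Import ring lra zify.

(** Put [f = ln Gamma]. Bernoulli's inequality [u^h <= 1 - h + h u] under Euler's
integral gives [Gamma (y + h) <= y^h Gamma y] for [0 <= h <= 1]; with
[Gamma (y + 1) = y Gamma y] this traps every difference quotient of [f] at [y]
between [ln (y - 1)] and [ln y]. Shifting [x] to [y = x + N] and letting [N] grow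
shows that [f] is differentiable and
[digamma x = lim (ln N - sum_(k < N) 1 / (x + k))].

Consequently the discrete cosine transform of [nu |-> digamma (nu / n)] is a limit
of partial sums of [sum cos (2 m t) / m] at [t = pi j / n], whose value is
[- ln (2 sin t)]; at [j = 0] it is a harmonic sum, which produces Euler's constant.
The theorem is Parseval's identity for the cosine transform of [csc (pi nu / n)]
and [digamma (nu / n)]: the cosecant is even under [nu <-> n - nu], so that only the
even part of the second sequence, which the cosine transform determines, matters. *)

Set Implicit Arguments.
Unset Strict Implicit.
Unset Printing Implicit Defensive.

Import Order.TTheory GRing.Theory Num.Theory.
Import numFieldNormedType.Exports.

Local Open Scope classical_set_scope.
Local Open Scope ring_scope.

(** * Euler's integral *)

Definition euler_kernel {R : realType} (p t : R) : R := t `^ p * expR (- t).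

(** Extended-real values allow monotone convergence before finiteness is known. [Gamma x] is the
    real part of this integral at [p = x - 1]. *)
Definition euler_integral {R : realType} (p : R) : \bar R :=
  (\int[lebesgue_measure]_(t in `]0%R, +oo[) (euler_kernel p t)%:E)%E.

Section EulerIntegral.
Variable R : realType.
Local Notation mu := (@lebesgue_measure R).
Implicit Types p t : R.

Lemma euler_kernel_ge0 p t : 0 <= euler_kernel p t.
Proof. by rewrite mulr_ge0 ?powR_ge0 ?expR_ge0. Qed.

Lemma measurable_euler_kernel p (D : set R) : measurable_fun D (euler_kernel p).
Proof.
apply: measurable_funTS; apply: measurable_funM; first exact: measurable_powR.
by apply: measurableT_comp => //; exact: oppr_measurable.
Qed.

Lemma euler_integral_ge0 p : (0 <= euler_integral p)%E.
Proof. by apply: integral_ge0 => t _; rewrite lee_fin euler_kernel_ge0. Qed.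

(** Compact intervals exhausting the open half-line. Starting from [k.+2] keeps the endpoints
    distinct, as integration by parts requires. *)
Definition expanding_itv (k : nat) : set R := `[k.+2%:R^-1, k.+2%:R].

Lemma bigcup_expanding_itv : \bigcup_k expanding_itv k = `]0, +oo[%classic.
Proof.
apply/seteqP; split => [t [k _]|t]; rewrite /expanding_itv /= !in_itv/=.
  by move=> /andP[+ _]; rewrite andbT; apply: lt_le_trans; rewrite invr_gt0.
rewrite andbT => t0.
have [k kt] : exists k : nat, t + t^-1 <= k.+2%:R.
  exists (Num.trunc (t + t^-1)).
  by apply/ltW/(lt_le_trans (truncnS_gt _)); rewrite ler_nat.
exists k => //; rewrite /expanding_itv /= in_itv/=; apply/andP; split.
  rewrite -[leRHS]invrK lef_pV2 ?posrE ?invr_gt0//.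
  by rewrite (le_trans _ kt)// lerDr ltW.
by rewrite (le_trans _ kt)// lerDl invr_ge0 ltW.
Qed.

Lemma nondecreasing_expanding_itv : nondecreasing_seq expanding_itv.
Proof.
move=> i j ij; rewrite subsetEset => t.
rewrite /expanding_itv /= !in_itv/= => /andP[it ti].
have ij2 : (i.+2%:R <= j.+2%:R :> R) by rewrite ler_nat !ltnS.
rewrite (le_trans ti)// andbT (le_trans _ it)//.
by rewrite lef_pV2 ?posrE.
Qed.

Lemma cvg_euler_integral p :
  (\int[mu]_(t in expanding_itv k) (euler_kernel p t)%:E @[k --> \oo] -->
   euler_integral p)%E.
Proof.
rewrite /euler_integral -bigcup_expanding_itv.
apply: ge0_nondecreasing_set_cvg_integral.
- exact: nondecreasing_expanding_itv.
- by move=> k; exact: measurable_itv.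
- by move=> k; apply/measurable_EFinP; exact: measurable_euler_kernel.
- by move=> k t _; rewrite lee_fin euler_kernel_ge0.
Qed.

Lemma is_derive_expRN (t : R) : is_derive t 1 (fun s => - expR (- s)) (expR (- t)).
Proof.
apply: is_derive_eq.
by rewrite mulrN1 opprK.
Qed.

Lemma continuous_powR p t : 0 < t -> {for t, continuous (fun s => s `^ p)}.
Proof.
move=> t0; apply: differentiable_continuous; apply/derivable1_diffP.
by apply: derivable_powR; rewrite in_itv/= t0.
Qed.

Lemma euler_kernel_by_parts p (a b : R) : 0 <= p -> 0 < a -> a < b ->
  (\int[mu]_(t in `[a, b]) (euler_kernel p t)%:E =
   (euler_kernel p a - euler_kernel p b)%:E +
    \int[mu]_(t in `[a, b]) (p * euler_kernel (p - 1) t)%:E)%E.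
Proof.
move=> p0 a0 ab; have b0 : 0 < b by exact: lt_trans ab.
have cpow q t : t \in `[a, b] -> {for t, continuous (fun s : R => s `^ q)}.
  by rewrite in_itv/= => /andP[at_ _]; apply/continuous_powR/(lt_le_trans a0).
have cexp : continuous (fun s : R => expR (- s)).
  move=> t; apply: continuous_comp; first exact: opp_continuous.
  exact: continuous_expR.
rewrite (@integration_by_parts R (fun t => t `^ p) (fun t => - expR (- t))
  (fun t => p * t `^ (p - 1)) (fun t => expR (- t)) a b ab).
- congr (_ + _)%E; first by congr EFin; rewrite /euler_kernel; ring.
  under eq_integral do rewrite mulrN EFinN.
  (* Since [0 <= p], the integrand is nonnegative, so the sign may leave the extended-real
     integral. *)
  rewrite integral_ge0N ?oppeK; last first.
    by move=> t _; rewrite lee_fin !mulr_ge0 ?powR_ge0 ?expR_ge0.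
  by apply: eq_integral => t _; rewrite /euler_kernel mulrA.
- apply: continuous_in_subspaceT => t /set_mem/= tab.
  by apply: cvgM; [exact: cvg_cst|exact: cpow].
- split.
  + move=> t /[!in_itv]/= /andP[at_ _]; apply: derivable_powR.
    by rewrite in_itv/= andbT (lt_trans a0).
  + by apply: cvg_at_right_filter; exact: continuous_powR.
  + by apply: cvg_at_left_filter; exact: continuous_powR.
- move=> t /[!in_itv]/= /andP[at_ _]; apply: powR_derive1.
  by rewrite in_itv/= andbT (lt_trans a0).
- by apply: continuous_subspaceT.
- split.
  + by move=> t _; apply: ex_derive; exact: is_derive_expRN.
  + by apply: cvg_at_right_filter; apply: cvgN; exact: cexp.
  + by apply: cvg_at_left_filter; apply: cvgN; exact: cexp.
- move=> t _; rewrite derive1E; apply: derive_val; exact: is_derive_expRN.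
Qed.

(** For [t >= 1] the power is at most [t ^+ m], and the exponential dominates the single term
    [t ^+ m.+1 / (m.+1)!] of its series. *)
Lemma euler_kernel_le_inv p t m : 1 <= t -> p <= m%:R ->
  euler_kernel p t <= (m.+1)`!%:R / t.
Proof.
move=> t1 pm; have t0 : 0 < t by exact: lt_le_trans t1.
rewrite /euler_kernel expRN ler_pdivrMr ?expR_gt0//.
apply: (@le_trans _ _ (t ^+ m)).
  by rewrite -(powR_mulrn m (ltW t0)); exact: ler_powR.
rewrite mulrAC ler_pdivlMr// -exprSr.
rewrite mulrC -ler_pdivrMr ?ltr0n ?fact_gt0//.
by apply: le_trans (expR_ge1Dxn m (ltW t0)); rewrite lerDr.
Qed.

Lemma cvg_invSS : (k.+2%:R^-1 : R) @[k --> \oo] --> (0 : R).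
Proof.
by have := @cvg_harmonic R; rewrite -cvg_shiftS.
Qed.

Lemma cvg_euler_kernel0 p : 0 < p ->
  euler_kernel p (k.+2%:R^-1 : R) @[k --> \oo] --> (0 : R).
Proof.
move=> p0; apply: (@squeeze_cvgr _ _ _ _ (cst 0) (fun k => k.+2%:R^-1 `^ p)).
- near=> k; rewrite euler_kernel_ge0/= /euler_kernel ler_piMr ?powR_ge0//.
- exact: cvg_cst.
- have /cvg_at_rightP := powR_cvg0 p0.
  by apply; split; [move=> k; rewrite invr_gt0|exact: cvg_invSS].
Unshelve. all: by end_near. Qed.

Lemma cvg_euler_kernely p :
  euler_kernel p (k.+2%:R : R) @[k --> \oo] --> (0 : R).
Proof.
pose m := (Num.trunc p).+1.
have pm : p <= m%:R by exact/ltW/truncnS_gt.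
apply: (@squeeze_cvgr _ _ _ _ (cst 0) (fun k => (m.+1)`!%:R / k.+2%:R)).
- near=> k; rewrite euler_kernel_ge0/= euler_kernel_le_inv//.
  by rewrite ler1n.
- exact: cvg_cst.
- by rewrite -[X in _ --> X](mulr0 (m.+1)`!%:R); apply: cvgM (cvg_cst _) cvg_invSS.
Unshelve. all: by end_near. Qed.

(** Integration by parts on the compact intervals, whose boundary terms vanish in the limit. Because
    the equality holds in the extended reals, it can also carry finiteness from [p] to [p - 1]. *)
Lemma euler_integralD1 p : 0 < p ->
  (euler_integral p = p%:E * euler_integral (p - 1))%E.
Proof.
move=> p0.
have h k : (\int[mu]_(t in expanding_itv k) (euler_kernel p t)%:E =
   (euler_kernel p k.+2%:R^-1 - euler_kernel p k.+2%:R)%:E +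
    p%:E * \int[mu]_(t in expanding_itv k) (euler_kernel (p - 1) t)%:E)%E.
  rewrite euler_kernel_by_parts ?ltW//.
  - congr (_ + _)%E; under eq_integral do rewrite EFinM.
    rewrite ge0_integralZl_EFin ?ltW//.
    + by move=> t _; rewrite lee_fin euler_kernel_ge0.
    + by apply/measurable_EFinP; exact: measurable_euler_kernel.
  - by rewrite (@lt_trans _ _ 1)// ?invf_lt1// ltr1n.
have := @cvg_euler_integral p.
under eq_cvg do rewrite h.
move=> /cvg_unique; apply => //.
rewrite -[(_ * _)%E]add0e; apply: cvgeD => //.
- apply: cvg_EFin; first exact: nearW.
  rewrite -[X in _ --> X](subr0 0); apply: cvgB.
    exact: cvg_euler_kernel0.
  exact: cvg_euler_kernely.
- by apply: cvgeZl => //; exact: cvg_euler_integral.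
Qed.

Lemma euler_integral0 : euler_integral (0 : R) = 1%:E.
Proof.
have cexp : continuous (fun s : R => expR (- s)).
  move=> t; apply: continuous_comp; first exact: opp_continuous.
  exact: continuous_expR.
rewrite /euler_integral.
rewrite integral_itv_obnd_cbnd; last first.
  by apply/measurable_EFinP; exact: measurable_euler_kernel.
under eq_integral do rewrite /euler_kernel powRr0 mul1r.
rewrite (@ge0_continuous_FTC2y R _ (fun t => - expR (- t)) 0 0).
- by rewrite oppr0 expR0 EFinN oppeK add0e.
- by move=> t _; exact: expR_ge0.
- exact: continuous_subspaceT.
- rewrite -[X in _ --> X]oppr0; apply: cvgN; exact: cvgr_expR.
- by move=> t _; apply: ex_derive; exact: is_derive_expRN.
- by apply: cvg_at_right_filter; apply: cvgN; exact: cexp.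
- by move=> t _; rewrite derive1E; apply: derive_val; exact: is_derive_expRN.
Qed.

Lemma euler_integral_nat m : euler_integral (m%:R : R) = (m`!%:R)%:E.
Proof.
elim: m => [|m ih]; first by rewrite euler_integral0.
rewrite euler_integralD1// -natr1 addrK ih -EFinM; congr EFin.
by rewrite factS natrM natr1.
Qed.

(** For [p >= 0] the power [t^p] is at most [1 + t^m] with [m] an integer above [p] (split at
    [t = 1]), and integer exponents integrate to factorials. Exponents in []-1, 0[] follow from the
    functional equation. *)
Lemma euler_integral_fin_num p : -1 < p -> euler_integral p \is a fin_num.
Proof.
have pos (q : R) : 0 <= q -> euler_integral q \is a fin_num.
  move=> q0; rewrite ge0_fin_numE ?euler_integral_ge0//.
  pose m := (Num.trunc q).+1.
  have qm : q <= m%:R by exact/ltW/truncnS_gt.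
  apply: (@le_lt_trans _ _ (euler_integral 0 + euler_integral (m%:R : R)))%E.
    rewrite -ge0_integralD//; last 4 first.
    - by move=> t _; rewrite lee_fin euler_kernel_ge0.
    - by apply/measurable_EFinP; exact: measurable_euler_kernel.
    - by move=> t _; rewrite lee_fin euler_kernel_ge0.
    - by apply/measurable_EFinP; exact: measurable_euler_kernel.
    apply: ge0_le_integral => //.
    - by move=> t _; rewrite lee_fin euler_kernel_ge0.
    - by apply/measurable_EFinP; exact: measurable_euler_kernel.
    - apply: emeasurable_funD.
        by apply/measurable_EFinP; exact: measurable_euler_kernel.
      by apply/measurable_EFinP; exact: measurable_euler_kernel.
    move=> t; rewrite /= in_itv/= andbT => t0.
    rewrite -EFinD lee_fin /euler_kernel -mulrDl ler_wpM2r ?expR_ge0//.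
    have [t1|t1] := leP t 1.
      rewrite powRr0 (@le_trans _ _ 1) ?lerDl ?powR_ge0//.
      by rewrite -(powRr0 t) ger_powR ?t0.
    by rewrite (@le_trans _ _ (t `^ m%:R)) ?lerDr ?powR_ge0// ler_powR// ltW.
  by rewrite euler_integral0 euler_integral_nat ltry.
move=> p1; have [/pos//|p0] := leP 0 p.
have p10 : 0 < p + 1 by rewrite -ltrBlDr sub0r.
(* An infinite value at [p], multiplied by the positive number [p + 1], would make the finite value
   at [p + 1] infinite. *)
have := euler_integralD1 p10; rewrite addrK => h.
have := pos _ (ltW p10); rewrite h.
have := euler_integral_ge0 p.
move: (euler_integral p) => [r _ _|_|//]; first by [].
by rewrite gt0_muley ?lte_fin.
Qed.

Lemma powR_le_affine (u h : R) : 0 < u -> 0 <= h <= 1 ->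
  u `^ h <= 1 - h + h * u.
Proof.
move=> u0 /andP[h0 h1].
have w0 : 0 < 1 - h + h * u.
  have [->|hn0] := eqVneq h 0; first by rewrite mul0r subr0 addr0.
  by rewrite ltr_wpDl ?subr_ge0// mulr_gt0// lt0r hn0.
move: w0; set w := 1 - h + h * u => w0.
have ww : (1 - h + h * u) / w = 1 by rewrite divff ?gt_eqF.
clearbody w.
have lnle (v : R) : 0 < v -> ln v <= v - 1.
  by move=> v0; have := @le_ln1Dx R (v - 1); rewrite addrCA subrr addr0; apply; lra.
rewrite -ler_ln ?posrE ?powR_gt0// ln_powR.
(* Concavity of [ln] through its tangent at 1: the bounds [ln v <= v - 1] at [v = 1 / w] and
   [v = u / w], weighted by [1 - h] and [h], have right-hand sides summing to 0 since [w] is the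
   weighted mean of 1 and [u]. *)
have := lnle (u / w); have := lnle w^-1.
rewrite ln_div ?posrE// lnV ?posrE// divr_gt0// invr_gt0 => /(_ w0) + /(_ isT).
rewrite -subr_ge0 => a; rewrite -subr_ge0 => b.
have : 0 <= (1 - h) * (w^-1 - 1 - - ln w) + h * (u / w - 1 - (ln u - ln w)).
  by rewrite addr_ge0// mulr_ge0// subr_ge0.
have -> : (1 - h) * (w^-1 - 1 - - ln w) + h * (u / w - 1 - (ln u - ln w)) =
  (1 - h + h * u) / w - 1 + ln w - h * ln u by ring.
by rewrite ww subrr add0r subr_ge0.
Qed.

End EulerIntegral.

(** * The Gamma function *)

Section GammaFunction.
Variable R : realType.
Local Notation mu := (@lebesgue_measure R).
Implicit Types x y h : R.

Lemma Gamma_EFin x : 0 < x -> (Gamma x)%:E = euler_integral (x - 1).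
Proof. by move=> x0; rewrite [LHS]fineK// euler_integral_fin_num//; lra. Qed.

Lemma GammaD1 x : 0 < x -> Gamma (x + 1) = x * Gamma x.
Proof.
move=> x0; apply: EFin_inj; rewrite EFinM !Gamma_EFin ?addr_gt0// addrK.
exact: euler_integralD1.
Qed.

Lemma GammaS m : Gamma (m.+1%:R : R) = m`!%:R.
Proof. by apply: EFin_inj; rewrite Gamma_EFin// -natr1 addrK euler_integral_nat. Qed.

Lemma Gamma_le_powR y h : 0 < y -> 0 <= h <= 1 ->
  Gamma (y + h) <= y `^ h * Gamma y.
Proof.
move=> y0 /andP[h0 h1]; have yh0 : 0 < y + h by rewrite ltr_pwDl.
rewrite -lee_fin EFinM !Gamma_EFin//.
(* Bernoulli's inequality at u = t / y, multiplied by y^h. *)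
pose A := y `^ h * (1 - h); pose B := y `^ h * (h / y).
have A0 : 0 <= A by rewrite mulr_ge0 ?powR_ge0 ?subr_ge0.
have B0 : 0 <= B by rewrite mulr_ge0 ?powR_ge0 // divr_ge0 // ltW.
(* The affine majorant integrates exactly to the claimed bound: [euler_integral y] is [y] times
   [euler_integral (y - 1)], and [A + B * y = y^h]. *)
have -> : ((y `^ h)%:E * euler_integral (y - 1) =
    A%:E * euler_integral (y - 1) + B%:E * euler_integral y)%E.
  rewrite [X in (_ = _ + _ * X)%E]euler_integralD1//.
  rewrite muleA -EFinM -ge0_muleDl; last 2 first.
  - by rewrite lee_fin.
  - by rewrite lee_fin mulr_ge0// ltW.
  congr (_ * _)%E; rewrite -EFinD; congr EFin; rewrite /A /B.
  by rewrite -mulrA divfK ?gt_eqF// -mulrDr subrK mulr1.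
have mk p (D : set R) : measurable_fun D (fun t => (euler_kernel p t)%:E).
  by apply/measurable_EFinP; exact: measurable_euler_kernel.
have mkc c p (D : set R) :
    measurable_fun D (fun t => (c%:E * (euler_kernel p t)%:E)%E).
  have : measurable_fun D (EFin \o (fun t => c * euler_kernel p t)).
    apply/measurable_EFinP/measurable_funM; first exact: measurable_cst.
    exact: measurable_euler_kernel.
  by [].
have zl p (c : R) : 0 <= c -> (c%:E * euler_integral p =
    \int[mu]_(t in `]0%R, +oo[) (c%:E * (euler_kernel p t)%:E))%E.
  move=> c0; rewrite ge0_integralZl_EFin//; last exact: mk.
  by move=> t _; rewrite lee_fin euler_kernel_ge0.
rewrite !zl//.
rewrite -ge0_integralD//; last 4 first.
- by move=> t _; rewrite mule_ge0// lee_fin euler_kernel_ge0.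
- exact: mkc.
- by move=> t _; rewrite mule_ge0// lee_fin euler_kernel_ge0.
- exact: mkc.
apply: ge0_le_integral => //.
- by move=> t _; rewrite lee_fin euler_kernel_ge0.
- exact: mk.
- by apply: emeasurable_funD; exact: mkc.
move=> t; rewrite /= in_itv/= andbT => t0.
rewrite -!EFinM -EFinD lee_fin /euler_kernel !mulrA -mulrDl ler_wpM2r ?expR_ge0//.
have tn0 : t != 0 by rewrite gt_eqF.
rewrite addrAC (@powRD _ t (y - 1) h) ?tn0 ?implybT// [leLHS]mulrC.
rewrite -[t `^ y](@mulr_powRB1 _ t y (ltW t0) y0) mulrA -mulrDl.
rewrite ler_wpM2r ?powR_ge0//.
have -> : t `^ h = y `^ h * (t / y) `^ h.
  by rewrite -powRM ?divr_ge0 ?(ltW t0) ?(ltW y0)// mulrC divfK ?gt_eqF.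
rewrite /A /B -mulrA -mulrDr ler_wpM2l ?powR_ge0//.
apply: le_trans (powR_le_affine _ _) _; rewrite ?divr_gt0 ?h0//.
by rewrite lerD2l mulrA mulrAC.
Qed.

(** The upper bound [Gamma_le_powR], read from [x] up to the next integer [m.+1], bounds [Gamma x]
    from below by a positive multiple of [m!]. *)
Lemma Gamma_gt0 x : 0 < x -> 0 < Gamma x.
Proof.
move=> x0; pose m := Num.trunc x.
have /andP[mx xm] : m%:R <= x < m.+1%:R by rewrite truncn_le ?truncnS_gt// ltW.
have := @Gamma_le_powR x (m.+1%:R - x) x0.
rewrite addrCA subrr addr0 GammaS; set b := _ && _ => h.
have {}h : m`!%:R <= x `^ (m.+1%:R - x) * Gamma x.
  by apply: h; rewrite /b subr_ge0 ltW//= lerBlDr -natr1 addrC lerD2l.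
rewrite -(pmulr_rgt0 _ (powR_gt0 (m.+1%:R - x) x0)).
by rewrite (lt_le_trans _ h)// ltr0n fact_gt0.
Qed.

End GammaFunction.

(** * The digamma function as a limit *)

Section DigammaLimit.
Variable R : realType.
Implicit Types x y z h s : R.

Lemma ln_sub_le (a b : R) : 0 < a -> 0 < b -> ln b - ln a <= (b - a) / a.
Proof.
move=> a0 b0; rewrite -ln_div ?posrE// mulrBl divff ?gt_eqF//.
have := @le_ln1Dx R (b / a - 1); rewrite addrCA subrr addr0; apply.
by rewrite ltrBrDr addNr divr_gt0.
Qed.

(* Decreasing in N, and increasing once (x + N)^-1 is subtracted. *)
Definition digamma_seq x (N : nat) : R :=
  ln (x + N%:R) - \sum_(0 <= k < N) (x + k%:R)^-1.

Lemma is_cvg_digamma_seq x : 0 < x -> cvgn (digamma_seq x).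
Proof.
move=> x0; have xk (k : nat) : 0 < x + k%:R by rewrite ltr_pwDl.
apply: nonincreasing_is_cvgn.
  apply/nonincreasing_seqP => N; rewrite /digamma_seq big_nat_recr//=.
  have := ln_sub_le (xk N) (xk N.+1).
  by rewrite -natr1 addrA [_ + _ + 1 - _]addrAC subrr add0r mul1r; lra.
(* This lower bound is the value at [N = 0] of the increasing companion sequence. *)
exists (ln x - x^-1) => _ [N _ <-].
apply: (@le_trans _ _ (digamma_seq x N - (x + N%:R)^-1)); last first.
  by rewrite gerBl invr_ge0 ltW.
elim: N => [|N ih]; first by rewrite /digamma_seq big_geq// addr0 subr0.
apply: (le_trans ih); rewrite /digamma_seq big_nat_recr//=.
have := ln_sub_le (xk N.+1) (xk N).
have -> : (x + N%:R - (x + N.+1%:R)) / (x + N.+1%:R) = - (x + N.+1%:R)^-1.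
  by rewrite -natr1 opprD addrACA subrr add0r opprD addrA subrr add0r mulN1r.
by lra.
Qed.

(* [f] stands for the logarithm of the Gamma function. *)
Variable f : R -> R.
Hypothesis f_add1 : forall x, 0 < x -> f (x + 1) = ln x + f x.
Hypothesis f_add_le : forall x s, 0 < x -> 0 <= s <= 1 ->
  f (x + s) <= s * ln x + f x.

(** The lower bound uses [f_add_le] backwards: with [w = x + s - 1], a step [1 - s] from [w] reaches
    [x], while a unit step from [w] reaches [x + s] and adds exactly [ln w]. *)
Lemma log_slope_bounds x s : 0 < x -> 0 <= s <= 1 -> 1 < x + s ->
  s * ln (x + s - 1) <= f (x + s) - f x <= s * ln x.
Proof.
move=> x0 s01 xs1; have /andP[s0 s1] := s01.
have w0 : 0 < x + s - 1 by lra.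
have h1 := f_add_le x0 s01.
have h2 := f_add1 w0; rewrite subrK in h2.
have s01' : 0 <= 1 - s <= 1 by apply/andP; split; lra.
have h3 := f_add_le w0 s01'.
rewrite (_ : x + s - 1 + (1 - s) = x) in h3; last by ring.
move: (ln x) (ln _) (f (x + s)) (f x) (f _) h1 h2 h3 => a b c d e h1 h2 h3.
by apply/andP; split; lra.
Qed.

(** For negative [h] the increment is taken from [y + h] to [y]. Monotonicity of [ln] then widens
    both cases to bounds independent of [h]. *)
Lemma log_slope y h : 1 < y -> `|h| <= 1 -> h != 0 ->
  ln (y - 1) <= h^-1 * (f (y + h) - f y) <= ln y.
Proof.
move=> y1 /ler_normlP[h1 h2] hn0; have y0 : 0 < y by lra.
have [hneg|hpos|/eqP] := ltgtP h 0; last by rewrite (negbTE hn0).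
- have hy : 0 < y + h by lra.
  have h01 : 0 <= - h <= 1 by apply/andP; split; lra.
  have := @log_slope_bounds (y + h) (- h) hy h01.
  rewrite addrK => /(_ y1) /andP[a b].
  have c : ln (y + h) <= ln y by rewrite ler_ln ?posrE//; lra.
  rewrite ler_ndivlMl// ler_ndivrMl//.
  move: (ln _) (ln (y + h)) (ln y) (f y) (f _) a b c => A B C D E a b c.
  by apply/andP; split; nra.
- have h01 : 0 <= h <= 1 by apply/andP; split; lra.
  have yh : 1 < y + h by lra.
  have /andP[a b] := @log_slope_bounds y h y0 h01 yh.
  have c : ln (y - 1) <= ln (y + h - 1) by rewrite ler_ln ?posrE//; lra.
  rewrite ler_pdivlMl// ler_pdivrMl//.
  move: (ln (y - 1)) (ln (y + h - 1)) (ln y) (f y) (f _) a b c => A B C D E a b c.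
  by apply/andP; split; nra.
Qed.

Lemma log_addn x N : 0 < x ->
  f (x + N%:R) = f x + \sum_(0 <= k < N) ln (x + k%:R).
Proof.
move=> x0; elim: N => [|N ih]; first by rewrite big_geq// !addr0.
have xN : 0 < x + N%:R by rewrite ltr_pwDl.
have -> : x + N.+1%:R = x + N%:R + 1 by rewrite -natr1 addrA.
by rewrite f_add1// ih big_nat_recr//= [LHS]addrC -addrA.
Qed.

Lemma is_derive_sum_ln x N : 0 < x ->
  is_derive x 1 (fun z : R => \sum_(0 <= k < N) ln (z + k%:R))
    (\sum_(0 <= k < N) (x + k%:R)^-1).
Proof.
move=> x0; elim: N => [|N ih].
  rewrite big_geq// (_ : (fun _ => _) = cst 0); last first.
    by apply/funext => z; rewrite big_geq.
  exact: is_derive_cst.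
rewrite big_nat_recr//= (_ : (fun _ => _) =
    (fun z : R => \sum_(0 <= k < N) ln (z + k%:R)) + (fun z : R => ln (z + N%:R))).
  apply: is_deriveD.
  have xN : 0 < x + N%:R by rewrite ltr_pwDl.
  have := is_derive1_ln xN => d.
  have e : is_derive x 1 (fun z : R => z + N%:R) 1.
    by apply: is_derive_eq; rewrite addr0.
  by have := @is_derive1_comp _ _ (fun z : R => z + N%:R) x _ _ d e; rewrite mulr1.
by apply/funext => z; rewrite big_nat_recr.
Qed.

(** The quotient of [f] at [x] is its quotient at [y = x + N] minus that of a finite sum of
    logarithms. The three errors [e / 3] are the distance of [digamma_seq x N] from its limit, the
    width [ln y - ln (y - 1)], and the differentiation of the finite sum at fixed [N]. *)
Lemma is_derive_log_recurrence x : 0 < x ->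
  is_derive x 1 f (limn (digamma_seq x)).
Proof.
move=> x0; set L := limn _.
have cL : digamma_seq x @ \oo --> L by exact: is_cvg_digamma_seq.
suff c : h^-1 *: (f (h *: 1 + x) - f x) @[h --> 0^'] --> L.
  apply: DeriveDef; first by apply/cvg_ex; exists L; exact: c.
  exact/cvg_lim.
apply/cvgrPdist_le => e e0.
have e3 : 0 < e / 3 by rewrite divr_gt0.
have [N [N2 LN yN]] : exists N : nat, [/\ (2 <= N)%N,
    `|L - digamma_seq x N| <= e / 3 & (x + N%:R - 1)^-1 <= e / 3].
  move/cvgrPdist_le : cL => /(_ _ e3) [N1 _ HN1].
  (* One more than the integer exceeding [3 / e], since the width is bounded by the inverse of
     [x + N - 1]. *)
  pose N2 := (Num.trunc (e / 3)^-1).+2.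
  exists (maxn N1 (maxn 2 N2)); split.
  - by rewrite !leq_max leqnn orbT.
  - by apply: HN1; rewrite /= leq_max leqnn.
  have : (N2%:R <= (maxn N1 (maxn 2 N2))%:R :> R).
    by rewrite ler_nat !leq_max leqnn !orbT.
  set N := maxn _ _; move=> h.
  have : (e / 3)^-1 < (Num.trunc (e / 3)^-1).+1%:R by exact: truncnS_gt.
  move: h; rewrite /N2 -natr1 => h h'.
  have c0 : 0 < (e / 3)^-1 by rewrite invr_gt0.
  have xN : (e / 3)^-1 <= x + N%:R - 1.
    by set c := _^-1 in h' c0 *; lra.
  rewrite invf_ple ?posrE//.
  exact: lt_le_trans xN.
set y := x + N%:R.
have N2' : (2 <= N%:R :> R) by rewrite ler_nat.
have y1 : 1 < y by rewrite /y; lra.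
have [dS SE] := @is_derive_sum_ln x N x0.
have cS : h^-1 *: (\sum_(0 <= k < N) ln (h *: 1 + x + k%:R) -
    \sum_(0 <= k < N) ln (x + k%:R)) @[h --> 0^'] -->
    (\sum_(0 <= k < N) (x + k%:R)^-1).
  by rewrite -SE; exact: dS.
move/cvgrPdist_le : cS => /(_ _ e3) cS.
near=> h.
have hn0 : h != 0 by near: h; exact: nbhs_dnbhs_neq.
have h1 : `|h| <= 1.
  near: h; apply: dnbhs0_le; exact: ltr01.
have hx : `|h| < x by near: h; exact: dnbhs0_lt.
have xh0 : 0 < x + h by move/ltr_normlP : hx => [? ?]; lra.
have : `|\sum_(0 <= k < N) (x + k%:R)^-1 -
    h^-1 *: (\sum_(0 <= k < N) ln (h *: 1 + x + k%:R) -
    \sum_(0 <= k < N) ln (x + k%:R))| <= e / 3.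
  by near: h.
rewrite /GRing.scale/= mulr1 [h + x]addrC.
have /andP[P1 P2] := log_slope y1 h1 hn0.
have Ey := @log_addn x N x0.
have Eyh := @log_addn (x + h) N xh0.
have := @ln_sub_le (y - 1) y; rewrite opprB addrCA subrr addr0 mul1r => lny.
have y10 : 0 < y - 1 by lra.
have y0 : 0 < y by lra.
move: {lny} (lny y10 y0); rewrite -/y in yN => /le_trans/(_ yN) lny.
have yhE : y + h = x + h + N%:R by rewrite /y; ring.
rewrite yhE Eyh /y Ey -/y in P1 P2.
have SE' (A B C D : R) : h^-1 * (A + B - (C + D)) = h^-1 * (A - C) + h^-1 * (B - D).
  by ring.
rewrite SE' in P1 P2.
move: LN; rewrite /digamma_seq -/y.
move: (h^-1 * (_ - _)) (h^-1 * (_ - _)) P1 P2 => q S.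
move: (\sum_(0 <= k < N) (x + k%:R)^-1) (ln y) (ln (y - 1)) lny => D A B.
move=> AB P1 P2 /ler_normlP[LA LB] /ler_normlP[SA SB].
by apply/ler_normlP; split; lra.
Unshelve. all: by end_near. Qed.

End DigammaLimit.

(** * Derivative of Gamma, the limit formula for digamma, and Euler's constant *)

Section Digamma.
Variable R : realType.
Implicit Types x : R.

Lemma is_derive_Gamma x : 0 < x ->
  is_derive x 1 (@Gamma R) (Gamma x * limn (digamma_seq x)).
Proof.
move=> x0.
have D : is_derive x 1 (fun z : R => ln (Gamma z)) (limn (digamma_seq x)).
  apply: (is_derive_log_recurrence (f := fun z : R => ln (Gamma z))) => //.
  - by move=> y y0; rewrite GammaD1// lnM ?posrE ?Gamma_gt0.
  - move=> y s y0 s01; rewrite -ln_powR -lnM ?posrE ?powR_gt0 ?Gamma_gt0//.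
    rewrite ler_ln ?posrE ?mulr_gt0 ?powR_gt0 ?Gamma_gt0//.
      exact: Gamma_le_powR.
    by move/andP : s01 => [s0 _]; rewrite ltr_pwDl.
have Dexp := @is_derive1_comp _ _ (fun z : R => ln (Gamma z)) x _ _
  (is_derive_expR (ln (Gamma x))) D.
rewrite lnK ?posrE ?Gamma_gt0// in Dexp.
(* Exponential and logarithm cancel only where [Gamma] is positive, hence merely near [x]. *)
have E : \forall z \near x, (expR \o (fun z : R => ln (Gamma z))) z = Gamma z.
  near=> z; rewrite /= lnK// posrE Gamma_gt0//.
  near: z; exact: lt_nbhsr.
have [d e] := Dexp; split.
  exact: (near_eq_derivable E d).
by rewrite -e; apply/esym; apply: near_eq_derive.
Unshelve. all: by end_near. Qed.

Lemma digamma_lim x : 0 < x -> digamma x = limn (digamma_seq x).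
Proof.
move=> x0; have [_ e] := is_derive_Gamma x0.
by rewrite /digamma derive1E e mulrC mulKf// gt_eqF// Gamma_gt0.
Qed.

Lemma cvg_lnD_sub x : 0 < x -> (ln (x + N%:R) - ln N%:R : R) @[N --> \oo] --> (0 : R).
Proof.
move=> x0; rewrite -cvg_shiftS.
apply: (@squeeze_cvgr _ _ _ _ (cst 0) (fun N => x * N.+1%:R^-1)).
- near=> N; apply/andP; split.
    by rewrite subr_ge0 ler_ln ?posrE ?ltr_pwDl// lerDr ltW.
  have := @ln_sub_le R N.+1%:R (x + N.+1%:R).
  by rewrite addrK; apply=> //; rewrite ltr_pwDl.
- exact: cvg_cst.
- rewrite -[X in _ --> X](mulr0 x); apply: cvgM; [exact: cvg_cst|exact: cvg_harmonic].
Unshelve. all: by end_near. Qed.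

(** Replacing [ln (x + N)] by [ln N] gives all arguments [x] the same logarithm, which then factors
    out of the cosine transform. *)
Lemma digamma_cvg x : 0 < x ->
  (ln N%:R - \sum_(0 <= k < N) (x + k%:R)^-1 : R) @[N --> \oo] --> digamma x.
Proof.
move=> x0; rewrite digamma_lim// -[X in _ --> X]subr0.
have -> : (fun N : nat => ln N%:R - \sum_(0 <= k < N) (x + k%:R)^-1 : R) =
  (fun N => digamma_seq x N - (ln (x + N%:R) - ln N%:R)).
  by apply/funext => N; rewrite /digamma_seq; ring.
by apply: cvgB; [exact: is_cvg_digamma_seq|exact: cvg_lnD_sub].
Qed.

(** [euler_gamma] is defined by [lim], so convergence has to be established; up to sign the sequence
    is the one converging to [digamma 1]. *)
Lemma euler_gamma_cvg :
  (series harmonic N - ln N%:R : R) @[N --> \oo] --> (euler_gamma : R).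
Proof.
suff : cvgn (fun N : nat => series harmonic N - ln N%:R : R) by [].
apply/cvg_ex; exists (- digamma 1).
have -> : (fun N : nat => series harmonic N - ln N%:R : R) =
    - (fun N : nat => ln N%:R - \sum_(0 <= k < N) (1 + k%:R)^-1).
  apply/funext => N; rewrite [RHS]opprB; congr (_ - _).
  by rewrite seriesEnat/=; apply: eq_bigr => k _; rewrite nat1r.
by apply: cvgN; exact: digamma_cvg.
Qed.

End Digamma.

(** * The Fourier series of the log-sine *)

Section FourierLogSine.
Variable R : realType.
Implicit Types t : R.

Lemma is_derive_cosMl (c t : R) :
  is_derive t 1 (fun s : R => cos (c * s)) (- (c * sin (c * t))).
Proof.
have e : is_derive t 1 (fun s : R => c * s) c.
  by have := is_deriveZ c (is_derive_id t (1 : R)); rewrite /GRing.scale/= mulr1.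
have := @is_derive1_comp _ cos (fun s : R => c * s) t _ _ (is_derive_cos (c * t)) e.
by rewrite mulNr mulrC.
Qed.

Lemma is_derive_sinMl (c t : R) :
  is_derive t 1 (fun s : R => sin (c * s)) (c * cos (c * t)).
Proof.
have e : is_derive t 1 (fun s : R => c * s) c.
  by have := is_deriveZ c (is_derive_id t (1 : R)); rewrite /GRing.scale/= mulr1.
have := @is_derive1_comp _ sin (fun s : R => c * s) t _ _ (is_derive_sin (c * t)) e.
by rewrite mulrC.
Qed.

Definition cos_log_sum M t : R :=
  \sum_(0 <= m < M) cos (2 * m.+1%:R * t) / m.+1%:R.

Lemma is_derive_cos_log_sum M t :
  is_derive t 1 (cos_log_sum M)
    (- (2 * \sum_(0 <= m < M) sin (2 * m.+1%:R * t))).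
Proof.
elim: M => [|M ih].
  rewrite /cos_log_sum (_ : (fun _ => _) = cst 0); last first.
    by apply/funext => s; rewrite big_geq.
  by rewrite big_geq// mulr0 oppr0; exact: is_derive_cst.
rewrite (_ : cos_log_sum M.+1 =
    cos_log_sum M + (M.+1%:R^-1 \*: (fun s : R => cos (2 * M.+1%:R * s)))); last first.
  apply/funext => s; rewrite /cos_log_sum big_nat_recr//=.
  by congr (_ + _); rewrite mulrC.
have D := is_deriveD ih (is_deriveZ M.+1%:R^-1 (is_derive_cosMl (2 * M.+1%:R) t)).
apply: (is_derive_eq D).
rewrite big_nat_recr//= mulrDr opprD; congr (_ + _).
rewrite /GRing.scale/= mulrN; congr (- _).
move: (sin _) => S; field.
by rewrite nat1r pnatr_eq0.
Qed.

(** Product to sum: each term becomes a difference of cosines at consecutive odd multiples of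
    [t]. *)
Lemma sum_sin_telescope M t :
  2 * sin t * \sum_(0 <= m < M) sin (2 * m.+1%:R * t) =
  cos t - cos ((2 * M%:R + 1) * t).
Proof.
elim: M => [|M ih]; first by rewrite big_geq// !mulr0 add0r mul1r subrr.
rewrite big_nat_recr//= mulrDr ih.
have -> : (2 * M%:R + 1) * t = 2 * M.+1%:R * t - t by rewrite -natr1; ring.
have -> : (2 * M.+1%:R + 1) * t = 2 * M.+1%:R * t + t by ring.
by rewrite cosB cosD; ring.
Qed.

(* The last term integrates the oscillating part of the derivative of the first
   two, which leaves a derivative of size O(1/M). *)
Definition cos_log_defect M t : R :=
  cos_log_sum M t + ln (sin t) -
  sin ((2 * M%:R + 1) * t) / ((2 * M%:R + 1) * sin t).

(** The cotangent from [ln (sin t)] cancels the [cos t] part of the telescoped sum, and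
    differentiating the sine numerator of the correction cancels the rest. What remains comes from
    differentiating [1 / sin t]. *)
Lemma is_derive_cos_log_defect M t : 0 < sin t ->
  is_derive t 1 (cos_log_defect M)
    (sin ((2 * M%:R + 1) * t) * cos t / ((2 * M%:R + 1) * sin t ^+ 2)).
Proof.
move=> st; have k0 : 0 < 2 * M%:R + 1 :> R by rewrite ltr_wpDl ?mulr_ge0.
have D1 := is_derive_cos_log_sum M t.
have D2 := @is_derive1_comp _ (@ln R) sin t _ _ (is_derive1_ln st) (is_derive_sin t).
have D3 := is_derive_sinMl (2 * M%:R + 1) t.
have D4 := is_deriveZ (2 * M%:R + 1) (is_derive_sin t).
have s0 : ((2 * M%:R + 1) \*: @sin R) t != 0.
  by rewrite /= scaler_eq0 negb_or !gt_eqF.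
have D5 := is_deriveV s0 D4.
have D6 := is_deriveM D3 D5.
have D := is_deriveB (is_deriveD D1 D2) D6.
apply: (is_derive_eq D).
have := sum_sin_telescope M t.
rewrite /GRing.scale/=.
move: (\sum_(0 <= m < M) _) (sin _) (cos _) (cos t) (sin t) st k0 => S A B C s.
move: (2 * M%:R + 1) => c s_gt0 c_gt0 SE.
have cn0 : c != 0 by rewrite gt_eqF.
have sn0 : s != 0 by rewrite gt_eqF.
have -> : 2 * S = (C - B) / s by rewrite -SE; field.
have -> : c *: s = c * s by [].
by field; rewrite ?cn0 ?sn0.
Qed.

Lemma sin_ge_left (t c : R) : 0 < t -> t <= c -> c <= pi / 2 -> sin t <= sin c.
Proof.
move=> t0 tc cp; have p0 := pi_gt0 R.
move: tc; rewrite le_eqVlt => /predU1P[->//|tc].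
by rewrite ltW// ltr_sin// !in_itv/=; apply/andP; split; lra.
Qed.

(** Mean value theorem on [[t, pi / 2]], where sine is smallest at [t]. *)
Lemma cos_log_defect_bound M t : 0 < t <= pi / 2 ->
  `|cos_log_defect M (pi / 2) - cos_log_defect M t| <=
    pi / 2 / sin t ^+ 2 / (2 * M%:R + 1).
Proof.
move=> /andP[t0 tp]; have p0 := pi_gt0 R.
have st : 0 < sin t by rewrite sin_gt0_pi// t0/=; lra.
have k0 : 0 < 2 * M%:R + 1 :> R by rewrite ltr_wpDl ?mulr_ge0.
have sc c : c \in `[t, pi / 2] -> sin t <= sin c.
  by rewrite in_itv/= => /andP[]; exact: sin_ge_left.
have dD c : c \in `[t, pi / 2] -> is_derive c 1 (cos_log_defect M)
    (sin ((2 * M%:R + 1) * c) * cos c / ((2 * M%:R + 1) * sin c ^+ 2)).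
  by move=> ct; apply: is_derive_cos_log_defect; apply: (lt_le_trans st); exact: sc.
pose df c : R := sin ((2 * M%:R + 1) * c) * cos c / ((2 * M%:R + 1) * sin c ^+ 2).
have cont : {within `[t, pi / 2], continuous (cos_log_defect M)}.
  apply: derivable_within_continuous => c ct.
  by apply: ex_derive; exact: dD.
have dDo c : c \in `]t, pi / 2[ -> is_derive c 1 (cos_log_defect M) (df c).
  by move=> ct; apply: dD; apply: subset_itv_oo_cc ct.
move: cont dDo.
clear dD; move: (cos_log_defect M) => g cont dDo.
have [c ct cE] := MVT_segment tp dDo cont.
rewrite (congr1 Num.norm cE).
have sct := sc _ ct; have s0 := lt_le_trans st sct.
rewrite normrM [X in _ * X]ger0_norm ?subr_ge0//.
rewrite [leRHS]mulrAC [leRHS]mulrAC -mulrA [leRHS]mulrC.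
apply: ler_pM => //; last by lra.
- by rewrite subr_ge0.
rewrite /df normrM normrM normfV [X in _ / X]ger0_norm; last first.
  by rewrite mulr_ge0 ?ltW// exprn_gt0.
rewrite [leRHS](_ : _ = 1 * 1 / ((2 * M%:R + 1) * sin t ^+ 2)); last first.
  by rewrite mulr1 mul1r -invfM mulrC.
apply: ler_pM.
- by rewrite mulr_ge0.
- by rewrite invr_ge0 mulr_ge0 ?ltW// exprn_gt0.
- by apply: ler_pM => //; [exact: sin_max|exact: cos_max].
rewrite lef_pV2 ?posrE ?mulr_gt0 ?exprn_gt0// ler_wpM2l ?(ltW k0)//.
by rewrite lerXn2r// nnegrE ltW.
Qed.

Lemma cos_mul_pi (m : nat) : cos (m%:R * pi : R) = (-1) ^+ m.
Proof.
elim: m => [|m ih]; first by rewrite mul0r cos0.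
by rewrite -natr1 mulrDl mul1r cosDpi ih exprSr mulrN1.
Qed.

(** At [pi / 2] the sum is alternating harmonic: twice its even-index terms, which give
    [series harmonic N], minus all terms. An even length completes the pairs. *)
Lemma cos_log_sum_pihalf N : cos_log_sum N.*2 (pi / 2) =
  series harmonic N - series harmonic N.*2.
Proof.
elim: N => [|N ih]; first by rewrite /cos_log_sum !seriesEnat/= !big_geq// subrr.
have := ih; rewrite doubleS /cos_log_sum !seriesEnat/= => {}ih.
rewrite !big_nat_recr//= ih.
have e m : cos (2 * m%:R * (pi / 2) : R) = (-1) ^+ m.
  by rewrite -cos_mul_pi; congr cos; field.
rewrite !e exprS !exprS -signr_odd odd_double/= !mulr1.
have -> : N.*2.+2%:R = 2 * N.+1%:R :> R by rewrite -doubleS -muln2 natrM mulrC.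
have : N.+1%:R != 0 :> R by rewrite pnatr_eq0.
have : N.*2.+1%:R != 0 :> R by rewrite pnatr_eq0.
move: (N.*2.+1%:R) (N.+1%:R) (\sum_(0 <= i < N) _) (\sum_(0 <= i < N.*2) _).
by move=> a b A B a0 b0; field; rewrite a0 b0.
Qed.

Lemma cvgn_double : N.*2 @[N --> \oo] --> \oo.
Proof.
rewrite (_ : [eta double] = muln 2); last by apply/funext => N; rewrite mul2n.
exact: cvg_mulnl.
Qed.

Lemma cvg_harmonic_sub_double :
  (series harmonic N - series harmonic N.*2 : R) @[N --> \oo] --> - ln (2 : R).
Proof.
have c1 := @euler_gamma_cvg R.
have c2 := cvg_comp _ _ cvgn_double c1.
have c3 : (series harmonic N - ln N%:R - (series harmonic N.*2 - ln N.*2%:R) - ln 2)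
    @[N --> \oo] --> (euler_gamma - euler_gamma - ln 2 : R).
  by apply: cvgB (cvg_cst _); apply: cvgB.
move: c3; rewrite subrr sub0r; apply: cvg_trans; apply: near_eq_cvg; near=> N.
have N0 : 0 < N%:R :> R by rewrite ltr0n; near: N; exact: nbhs_infty_gt.
have -> : ln N.*2%:R = ln N%:R + ln 2 :> R by rewrite -muln2 natrM lnM ?posrE.
by ring.
Unshelve. all: by end_near. Qed.

(** The three summands of the constant come from the mean value bound and from the sine corrections
    at [pi / 2] and at [t]. *)
Lemma cos_log_sum_dist M t : 0 < t <= pi / 2 ->
  `|cos_log_sum M t - (cos_log_sum M (pi / 2) - ln (sin t))| <=
    (pi / 2 / sin t ^+ 2 + 1 + (sin t)^-1) / (2 * M%:R + 1).
Proof.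
move=> tp; have /andP[t0 tp2] := tp; have p0 := pi_gt0 R.
have st : 0 < sin t by rewrite sin_gt0_pi// t0/=; lra.
have k0 : 0 < 2 * M%:R + 1 :> R by rewrite ltr_wpDl ?mulr_ge0.
have := cos_log_defect_bound M tp.
rewrite /cos_log_defect sin_pihalf ln1 addr0 mulr1.
have b (x y : R) : 0 < x -> `|sin y / ((2 * M%:R + 1) * x)| <= x^-1 / (2 * M%:R + 1).
  move=> x0; rewrite normrM normfV [`|_ * x|]gtr0_norm ?mulr_gt0//.
  rewrite -invfM mulrC [x * _]mulrC ler_piMr ?sin_max// invr_ge0.
  by rewrite mulr_ge0 ?(ltW k0) ?(ltW x0).
have := b _ ((2 * M%:R + 1) * t) st.
have := b _ ((2 * M%:R + 1) * (pi / 2)) ltr01; rewrite mulr1 invr1.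
rewrite !mulrDl.
move: (sin _ / _) (sin _ / _) (cos_log_sum M t) (cos_log_sum M _) (ln _) => A B C D E.
move: (_ / _) (_ / _) (_ / _) => u v w.
move=> /ler_normlP[h1 h2] /ler_normlP[h3 h4] /ler_normlP[h5 h6].
by apply/ler_normlP; split; lra.
Qed.

Lemma cvg_cos_log_sum_left t : 0 < t <= pi / 2 ->
  cos_log_sum N.*2 t @[N --> \oo] --> - ln (2 * sin t).
Proof.
move=> tp; have /andP[t0 tp2] := tp; have p0 := pi_gt0 R.
have st : 0 < sin t by rewrite sin_gt0_pi// t0/=; lra.
rewrite lnM ?posrE// opprD.
set K := pi / 2 / sin t ^+ 2 + 1 + (sin t)^-1.
have K0 : 0 <= K by rewrite !addr_ge0 ?divr_ge0 ?invr_ge0 ?exprn_ge0 ?(ltW st) ?(ltW p0).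
have c1 : (cos_log_sum N.*2 t - (cos_log_sum N.*2 (pi / 2) - ln (sin t)))
    @[N --> \oo] --> (0 : R).
  apply/norm_cvg0P.
  apply: (@squeeze_cvgr _ _ _ _ (cst 0) (fun N => K * N.+1%:R^-1)).
  - near=> N; rewrite normr_ge0/=; apply: le_trans (cos_log_sum_dist _ tp) _.
    rewrite ler_wpM2l// lef_pV2 ?posrE ?ltr_wpDl ?mulr_ge0//.
    rewrite -[N.+1%:R]natr1 lerD2r -muln2 natrM.
    by have : 0 <= N%:R :> R by []; lra.
  - exact: cvg_cst.
  - by rewrite -[X in _ --> X](mulr0 K); apply: cvgM; [exact: cvg_cst|exact: cvg_harmonic].
have c2 : (cos_log_sum N.*2 (pi / 2) - ln (sin t)) @[N --> \oo] --> (- ln 2 - ln (sin t)).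
  apply: cvgB; last exact: cvg_cst.
  under eq_cvg do rewrite cos_log_sum_pihalf.
  exact: cvg_harmonic_sub_double.
rewrite -[X in _ --> X]add0r.
have -> : (fun N => cos_log_sum N.*2 t) =
    (fun N => cos_log_sum N.*2 t - (cos_log_sum N.*2 (pi / 2) - ln (sin t))
      + (cos_log_sum N.*2 (pi / 2) - ln (sin t))).
  by apply/funext => N; rewrite subrK.
exact: cvgD.
Unshelve. all: by end_near. Qed.

Lemma cos_log_sum_reflect M t : cos_log_sum M (pi - t) = cos_log_sum M t.
Proof.
apply: eq_bigr => m _; congr (_ / _).
have -> : 2 * m.+1%:R * (pi - t) = - (2 * m.+1%:R * t) + m.+1%:R * pi + m.+1%:R * pi.
  by ring.
have cosDnpi (x : R) k : cos (x + k%:R * pi) = (-1) ^+ k * cos x.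
  elim: k => [|k ih]; first by rewrite mul0r addr0 mul1r.
  by rewrite -natr1 mulrDl mul1r addrA cosDpi ih exprSr mulrN1 mulNr.
by rewrite !cosDnpi cosN mulrA -exprD addnn -signr_odd odd_double mul1r.
Qed.

Lemma cvg_cos_log_sum t : 0 < t < pi ->
  cos_log_sum N.*2 t @[N --> \oo] --> - ln (2 * sin t).
Proof.
move=> /andP[t0 tp]; have [tp2|tp2] := leP t (pi / 2).
  by apply: cvg_cos_log_sum_left; rewrite t0.
have -> : sin t = sin (pi - t) by rewrite sinB sinpi cospi; ring.
have := @cvg_cos_log_sum_left (pi - t).
under eq_cvg do rewrite cos_log_sum_reflect.
by apply; apply/andP; split; lra.
Qed.

End FourierLogSine.

(** * The discrete cosine transform *)

Section DiscreteCosine.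
Variable R : realType.

Lemma itv_pi_ratio (n j : nat) : (0 < j < n)%N ->
  0 < (pi * j%:R / n%:R : R) < pi.
Proof.
move=> /andP[j0 jn]; have n0 : (0 < n)%N by exact: ltn_trans jn.
rewrite divr_gt0 ?mulr_gt0 ?pi_gt0 ?ltr0n//=.
by rewrite ltr_pdivrMr ?ltr0n// ltr_pM2l ?pi_gt0// ltr_nat.
Qed.

(** Product to sum again; the trailing [sin x] is the lower end [- sin (- x)] of the telescope. *)
Lemma sum_cos_telescope n (x : R) :
  2 * sin x * \sum_(0 <= j < n) cos (2 * j%:R * x) =
  sin ((2 * n%:R - 1) * x) + sin x.
Proof.
elim: n => [|n ih].
  by rewrite big_geq// !mulr0 sub0r mulN1r sinN addNr.
rewrite big_nat_recr//= mulrDr ih.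
have -> : (2 * n%:R - 1) * x = 2 * n%:R * x - x by ring.
have -> : (2 * n.+1%:R - 1) * x = 2 * n%:R * x + x by rewrite -natr1; ring.
by rewrite sinB sinD; ring.
Qed.

Lemma cos_add2pi_natmul (x : R) k : cos (x + 2 * pi * k%:R) = cos x.
Proof.
have -> : 2 * pi * k%:R = (pi *+ 2) *+ k :> R 
  by rewrite -[RHS]mulr_natr -[pi *+ 2]mulr_natl.
by rewrite periodicn//; exact: cosD2pi.
Qed.

Lemma sin_add2pi_natmul (x : R) k : sin (x + 2 * pi * k%:R) = sin x.
Proof.
have -> : 2 * pi * k%:R = (pi *+ 2) *+ k :> R.
  by rewrite -[RHS]mulr_natr -[pi *+ 2]mulr_natl.
by rewrite periodicn//; exact: sinD2pi.
Qed.

Lemma sum_cos_root (n k : nat) : (0 < n)%N ->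
  \sum_(0 <= j < n) cos (2 * pi * j%:R * k%:R / n%:R : R) =
  if (n %| k)%N then n%:R else 0.
Proof.
move=> n0; have nn0 : n%:R != 0 :> R by rewrite pnatr_eq0 -lt0n.
case: ifPn => [/dvdnP[q ->]|nk].
  rewrite (eq_bigr (fun => 1)); last first.
    move=> j _; rewrite (_ : _ / _ = 0 + 2 * pi * (j * q)%:R).
      by rewrite cos_add2pi_natmul cos0.
    by rewrite !natrM; field.
  by rewrite sumr_const_nat subn0.
pose x : R := pi * k%:R / n%:R.
have sx : sin x != 0.
  (* Reducing [k] modulo [n] changes the sine only by a sign and brings the angle into []0, pi[]. *)
  rewrite /x {1}(divn_eq k n) natrD natrM.
  have -> : pi * ((k %/ n)%:R * n%:R + (k %% n)%:R) / n%:R =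
    pi * (k %% n)%:R / n%:R + pi *+ (k %/ n) :> R.
    by rewrite -mulr_natr; field.
  rewrite alternatingn; last exact: sinDpi.
  rewrite mulf_neq0 ?signr_eq0// gt_eqF// sin_gt0_pi// itv_pi_ratio//.
  by rewrite lt0n nk ltn_mod.
apply: (mulfI (_ : 2 * sin x != 0)); first by rewrite mulf_neq0.
rewrite mulr0 (eq_bigr (fun j => cos (2 * j%:R * x))); last first.
  by move=> j _; congr cos; rewrite /x; ring.
rewrite sum_cos_telescope.
have nx : n%:R * x = pi * k%:R by rewrite /x mulrCA divff// mulr1.
have -> : (2 * n%:R - 1) * x = - x + 2 * (n%:R * x) by ring.
by rewrite nx mulrA sin_add2pi_natmul sinN addNr.
Qed.

(** Product to sum reduces to [sum_cos_root] at the difference and the sum of the frequencies. As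
    [l + nu < 2 n], the latter is a multiple of [n] only when it equals [n]. Both indicators fire
    when [l = nu = n / 2]. *)
Lemma sum_cos_orthogonal (n l nu : nat) : (0 < l < n)%N -> (0 < nu <= n)%N ->
  \sum_(0 <= j < n) cos (2 * pi * j%:R * l%:R / n%:R : R) *
    cos (2 * pi * j%:R * nu%:R / n%:R) =
  n%:R / 2 * ((nu == l)%:R + (nu == n - l)%N%:R).
Proof.
move=> /andP[l0 ln] /andP[nu0 nun]; have n0 : (0 < n)%N by lia.
(* The absolute difference: one of the truncated subtractions is 0, and cosine is even. *)
pose d := (l - nu + (nu - l))%N.
have -> : \sum_(0 <= j < n) cos (2 * pi * j%:R * l%:R / n%:R : R) *
    cos (2 * pi * j%:R * nu%:R / n%:R) =
  2^-1 * (\sum_(0 <= j < n) cos (2 * pi * j%:R * d%:R / n%:R : R) +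
          \sum_(0 <= j < n) cos (2 * pi * j%:R * (l + nu)%:R / n%:R : R)).
  rewrite -big_split/= mulr_sumr; apply: eq_bigr => j _.
  have -> : 2 * pi * j%:R * (l + nu)%:R / n%:R =
    2 * pi * j%:R * l%:R / n%:R + 2 * pi * j%:R * nu%:R / n%:R :> R.
    by rewrite natrD; ring.
  have -> : cos (2 * pi * j%:R * d%:R / n%:R : R) =
      cos (2 * pi * j%:R * l%:R / n%:R - 2 * pi * j%:R * nu%:R / n%:R).
    rewrite /d; have [le|le] := leqP nu l.
      rewrite (_ : (nu - l)%N = 0%N) ?addn0; last by lia.
      by congr cos; rewrite natrB//; ring.
    rewrite (_ : (l - nu)%N = 0%N) ?add0n; last by lia.
    by rewrite -cosN; congr cos; rewrite natrB ?(ltnW le)//; ring.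
  by rewrite cosB cosD; field.
rewrite !sum_cos_root//.
have -> : (n %| d)%N = (nu == l).
  apply/idP/eqP => [nd|nul]; last by rewrite /d nul subnn dvdn0.
  have [d0|d0] := posnP d; first by rewrite /d in d0; lia.
  by have := dvdn_leq d0 nd; rewrite /d; lia.
have -> : (n %| l + nu)%N = (nu == n - l)%N.
  apply/idP/eqP => [/dvdnP[[|[|q]] qE]|->]; [lia|lia| |by rewrite subnKC// ltnW].
  by nia.
by case: (nu == l); case: (nu == n - l)%N => /=; field.
Qed.

(** Orthogonality pairs [c l] with [psi l + psi (n - l)], and the symmetry of [c] folds the second
    half onto the first. The index [nu] runs up to [n] to cover all residues, as the digamma
    transform requires; the mode [nu = n] is constant in [j], hence orthogonal to every [l] here. *)
Lemma discrete_parseval (n : nat) (c psi : nat -> R) :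
  (forall l, (0 < l < n)%N -> c (n - l)%N = c l) ->
  \sum_(0 <= j < n)
    (\sum_(1 <= l < n) cos (2 * pi * j%:R * l%:R / n%:R) * c l) *
    (\sum_(1 <= nu < n.+1) cos (2 * pi * j%:R * nu%:R / n%:R) * psi nu) =
  n%:R * \sum_(1 <= l < n) psi l * c l.
Proof.
move=> csym.
pose e j l : R := cos (2 * pi * j%:R * l%:R / n%:R).
transitivity (\sum_(1 <= l < n) \sum_(1 <= nu < n.+1)
    c l * psi nu * \sum_(0 <= j < n) e j l * e j nu).
  transitivity (\sum_(0 <= j < n) \sum_(1 <= l < n) \sum_(1 <= nu < n.+1)
      c l * psi nu * (e j l * e j nu)).
    apply: eq_bigr => j _; rewrite big_distrl/=; apply: eq_bigr => l _.
    by rewrite big_distrr/=; apply: eq_bigr => nu _; rewrite /e; ring.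
  rewrite exchange_big/=; apply: eq_bigr => l _.
  by rewrite exchange_big/=; apply: eq_bigr => nu _; rewrite mulr_sumr.
have step l : (0 < l < n)%N ->
  \sum_(1 <= nu < n.+1) c l * psi nu * \sum_(0 <= j < n) e j l * e j nu =
  n%:R / 2 * (c l * psi l + c l * psi (n - l)%N).
  move=> /andP[l0 ln].
  pose D (k nu : nat) : R := c l * psi nu * (nu == k)%:R.
  have pick k : (0 < k < n)%N -> \sum_(1 <= nu < n.+1) D k nu = c l * psi k.
    move=> /andP[k0 kn].
    have kin : k \in index_iota 1 n.+1 by rewrite mem_index_iota k0 ltnS ltnW.
    rewrite (bigD1_seq k kin (iota_uniq _ _))/=.
    rewrite /D eqxx mulr1 big1 ?addr0// => i ik.
    by rewrite (negbTE ik) mulr0.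
  rewrite -[in RHS](pick l) ?l0// -[X in _ + X](pick (n - l)%N); last by lia.
  rewrite -big_split/= mulr_sumr big_nat_cond [RHS]big_nat_cond.
  apply: eq_bigr => nu /andP[/andP[nu1 nun] _].
  by rewrite sum_cos_orthogonal ?l0//; [rewrite /D; ring|lia].
rewrite big_nat_cond (eq_bigr (fun l =>
    n%:R / 2 * (c l * psi l + c l * psi (n - l)%N))); last first.
  by move=> l /andP[l1 _]; exact: step.
rewrite -big_nat_cond -mulr_sumr big_split/=.
have -> : \sum_(1 <= l < n) c l * psi (n - l)%N = \sum_(1 <= l < n) psi l * c l.
  rewrite big_nat_rev/= big_nat_cond [RHS]big_nat_cond.
  apply: eq_bigr => l /andP[/andP[l1 ln] _].
  rewrite add1n subSS csym ?l1//.
  by rewrite subKn ?(ltnW ln)// mulrC.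
under eq_bigr do rewrite mulrC.
by field.
Qed.

End DiscreteCosine.

(** * The transform of the digamma values *)

Section DigammaTransform.
Variable R : realType.

Lemma sum_nat_residues (f : nat -> R) n N :
  \sum_(0 <= i < n) \sum_(0 <= k < N) f (n * k + i)%N = \sum_(0 <= m < n * N) f m.
Proof.
rewrite exchange_big/=; elim: N => [|N ih]; first by rewrite muln0 !big_geq.
rewrite big_nat_recr//= ih mulnS addnC [RHS](@big_cat_nat _ _ _ (n * N))//=; last first.
  by rewrite leq_addr.
congr (_ + _); rewrite -{2}[(n * N)%N]add0n big_addn addKn.
by apply: eq_bigr => i _; rewrite addnC.
Qed.

Lemma sum_cos_root1 (n j : nat) : (0 < n)%N ->
  \sum_(1 <= nu < n.+1) cos (2 * pi * j%:R * nu%:R / n%:R : R) =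
  if (n %| j)%N then n%:R else 0.
Proof.
move=> n0; have nn0 : n%:R != 0 :> R by rewrite pnatr_eq0 -lt0n.
rewrite -(@sum_cos_root R n j n0) big_nat_recr//= [RHS]big_ltn//= addrC.
congr (_ + _).
  have -> : 2 * pi * j%:R * n%:R / n%:R = 0 + 2 * pi * j%:R :> R by field.
  by rewrite cos_add2pi_natmul mulr0 !mul0r.
by apply: eq_bigr => nu _; congr (cos (_ / _)); rewrite mulrAC.
Qed.

(** The term [1 / (nu / n + k)] equals [n / (n k + nu)], and the cosine depends only on [n k + nu]
    modulo [n], so the double sum over residues and quotients is one cosine sum of length
    [n * N]. *)
Lemma digamma_dct_partial (n j N : nat) : (0 < n)%N ->
  \sum_(1 <= nu < n.+1) cos (2 * pi * j%:R * nu%:R / n%:R : R) *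
    (ln N%:R - \sum_(0 <= k < N) (nu%:R / n%:R + k%:R)^-1) =
  (if (n %| j)%N then n%:R else 0) * ln N%:R -
    n%:R * cos_log_sum (n * N) (pi * j%:R / n%:R).
Proof.
move=> n0; have nn0 : n%:R != 0 :> R by rewrite pnatr_eq0 -lt0n.
under eq_bigr do rewrite mulrBr.
rewrite sumrB -mulr_suml sum_cos_root1//; congr (_ - _).
rewrite /cos_log_sum -sum_nat_residues mulr_sumr big_add1/=.
apply: eq_bigr => i _; rewrite !mulr_sumr; apply: eq_bigr => k _.
have -> : 2 * (n * k + i).+1%:R * (pi * j%:R / n%:R) =
  2 * pi * j%:R * i.+1%:R / n%:R + 2 * pi * (j * k)%:R :> R.
  by rewrite -[(n * k + i).+1]addnS natrD !natrM; field.
rewrite cos_add2pi_natmul mulrCA; congr (_ * _).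
have m0 : (n * k + i).+1%:R != 0 :> R by rewrite pnatr_eq0.
have -> : i.+1%:R / n%:R + k%:R = (n * k + i).+1%:R / n%:R :> R.
  by rewrite -[(n * k + i).+1]addnS natrD natrM; field.
by rewrite invf_div.
Qed.

Lemma cvg_digamma_dct (n j : nat) : (0 < n)%N ->
  ((if (n %| j)%N then n%:R else 0) * ln N%:R -
    n%:R * cos_log_sum (n * N) (pi * j%:R / n%:R)) @[N --> \oo] -->
  \sum_(1 <= nu < n.+1) cos (2 * pi * j%:R * nu%:R / n%:R : R) *
    digamma (nu%:R / n%:R : R).
Proof.
move=> n0.
have -> : (fun N => (if (n %| j)%N then n%:R else 0) * ln N%:R -
    n%:R * cos_log_sum (n * N) (pi * j%:R / n%:R) : R) =
    (fun N => \sum_(1 <= nu < n.+1 | (1 <= nu < n.+1)%N)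
      cos (2 * pi * j%:R * nu%:R / n%:R : R) *
      (ln N%:R - \sum_(0 <= k < N) (nu%:R / n%:R + k%:R)^-1)).
  by apply/funext => N; rewrite -digamma_dct_partial// big_nat.
rewrite [X in _ --> X]big_nat; apply: cvg_big => [|nu /andP[nu0 _]].
  exact: add_continuous.
apply: cvgM; first exact: cvg_cst.
by apply: digamma_cvg; rewrite divr_gt0// ltr0n.
Qed.

Lemma digamma_dct (n j : nat) : (0 < j < n)%N ->
  \sum_(1 <= nu < n.+1) cos (2 * pi * j%:R * nu%:R / n%:R : R) *
    digamma (nu%:R / n%:R : R) = n%:R * ln (2 * sin (pi * j%:R / n%:R)).
Proof.
move=> /andP[j0 jn]; have n0 : (0 < n)%N by lia.
(* The log-sine limit is available along even lengths, so the convergent transform is restricted to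
   doubled [N], which keeps its limit. *)
have c1 := cvg_comp _ _ cvgn_double (@cvg_digamma_dct n j n0).
apply: (cvg_unique _ c1) => //.
have ndj : (n %| j)%N = false by apply/negP => /(dvdn_leq j0); lia.
have t0 := @itv_pi_ratio R n j; rewrite j0 jn in t0.
have c2 := cvg_comp _ _ (cvg_mulnl _ n0) (cvg_cos_log_sum (t0 isT)).
have -> : n%:R * ln (2 * sin (pi * j%:R / n%:R)) =
  - (n%:R * - ln (2 * sin (pi * j%:R / n%:R))) :> R by rewrite mulrN opprK.
have -> : ((fun N => (if (n %| j)%N then n%:R else 0) * ln N%:R -
    n%:R * cos_log_sum (n * N) (pi * j%:R / n%:R)) \o [eta double]) =
    (fun N => - (n%:R * cos_log_sum (n * N).*2 (pi * j%:R / n%:R))) :> (nat -> R).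
  by apply/funext => N; rewrite /= ndj mul0r sub0r doubleMr.
apply: cvgN; apply: cvgM; first exact: cvg_cst.
exact: c2.
Qed.

Lemma cos_log_sum0 M : cos_log_sum M (0 : R) = series harmonic M.
Proof.
rewrite /cos_log_sum seriesEnat/=; apply: eq_bigr => m _.
by rewrite mulr0 cos0 mul1r.
Qed.

(** Frequency 0 of the transform, where the cosine sum is harmonic. It is the logarithmic derivative
    of Gauss's multiplication formula at [1 / n]. *)
Lemma sum_digamma (n : nat) : (0 < n)%N ->
  \sum_(1 <= nu < n.+1) digamma (nu%:R / n%:R : R) =
  - (n%:R * (euler_gamma + ln n%:R)).
Proof.
move=> n0; have := @cvg_digamma_dct n 0 n0.
rewrite dvdn0 mulr0 mul0r.
under [X in _ --> X -> _]eq_bigr do rewrite mulr0 !mul0r cos0 mul1r.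
move=> c1; apply: (cvg_unique _ c1) => //.
have c2 := cvg_comp _ _ (cvg_mulnl _ n0) (@euler_gamma_cvg R).
have c3 : - (n%:R * (series harmonic (n * N) - ln (n * N)%:R + ln n%:R)) @[N --> \oo] -->
    - (n%:R * (euler_gamma + ln n%:R) : R).
  by apply: cvgN; apply: cvgM; [exact: cvg_cst|apply: cvgD; [exact: c2|exact: cvg_cst]].
move: c3; apply: cvg_trans; apply: near_eq_cvg; near=> N.
have N0 : 0 < N%:R :> R by rewrite ltr0n; near: N; exact: nbhs_infty_gt.
rewrite cos_log_sum0 natrM lnM ?posrE ?(ltr0n R n)//.
by ring.
Unshelve. all: by end_near. Qed.

End DigammaTransform.

(** * Cosecant sums *)

Section CosecantSums.
Variable R : realType.

Lemma csc_sum_reflect (n l : nat) : (l <= n)%N -> (0 < n)%N ->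
  csc (pi * (n - l)%:R / n%:R : R) = csc (pi * l%:R / n%:R).
Proof.
move=> ln n0; rewrite /csc; congr (_^-1).
have nn0 : n%:R != 0 :> R by rewrite pnatr_eq0 -lt0n.
have -> : pi * (n - l)%:R / n%:R = pi - pi * l%:R / n%:R :> R.
  by rewrite natrB//; field.
by rewrite sinB sinpi cospi; ring.
Qed.

Lemma cos_csc_sum0 (n : nat) : cos_csc_sum R n 0 = csc_sum R n.
Proof. by apply: eq_bigr => l _; rewrite mulr0 !mul0r cos0 mul1r. Qed.

(** Adding the term [j = 0], which is [csc_sum R n], completes each cosine sum over [j] to a full
    period, and that vanishes for [0 < l < n]. *)
Lemma sum_cos_csc_sum (n : nat) : (0 < n)%N ->
  \sum_(1 <= j < n) cos_csc_sum R n j = - csc_sum R n.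
Proof.
move=> n0; apply/eqP; rewrite -addr_eq0 addrC -cos_csc_sum0 -big_ltn//.
rewrite exchange_big/= big_nat big1// => l /andP[l0 ln].
rewrite -mulr_suml sum_cos_root//.
by rewrite (_ : (n %| l)%N = false) ?mul0r//; apply/negP => /(dvdn_leq l0); lia.
Qed.

End CosecantSums.

(** * Parseval's identity for the cosecants and the digamma values *)

Theorem mainTheorem9 (R : realType) (n : nat) (hn : (2 <= n)%N) :
  \sum_(1 <= nu < n) digamma (nu%:R / n%:R : R) * csc (pi * nu%:R / n%:R)
  = - (euler_gamma + ln (2 * n%:R)) * csc_sum R n
    - \sum_(1 <= nu < n) cos_csc_sum R n nu * ln (csc (pi * nu%:R / n%:R)).
Proof.
have n0 : (0 < n)%N by lia.
have nn0 : n%:R != 0 :> R by rewrite pnatr_eq0 -lt0n.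
have := @discrete_parseval R n (fun l => csc (pi * l%:R / n%:R))
  (fun nu => digamma (nu%:R / n%:R)).
move=> /(_ _)/esym => /(_ _) H.
apply: (mulfI nn0); rewrite H; last first.
  by move=> l /andP[_ ln]; rewrite csc_sum_reflect// ltnW.
(* Frequency 0 is split off; it yields the part with Euler's constant and [ln n]. *)
rewrite big_ltn// -/(cos_csc_sum R n 0) cos_csc_sum0.
under [X in _ * X + _]eq_bigr do rewrite mulr0 !mul0r cos0 mul1r.
rewrite sum_digamma//.
(* In the other frequencies [ln (2 sin)] splits as [ln 2 - ln csc]. The constant [ln 2] meets the
   total of the cosecant transform, [- csc_sum R n], and so turns [ln n] into [ln (2 n)]. *)
rewrite (_ : \sum_(1 <= j < n) _ = n%:R * (ln 2 * - csc_sum R n -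
    \sum_(1 <= nu < n) cos_csc_sum R n nu * ln (csc (pi * nu%:R / n%:R)))).
  by rewrite lnM ?posrE ?ltr0n//; ring.
rewrite -sum_cos_csc_sum// mulr_sumr -sumrB mulr_sumr.
rewrite big_nat [RHS]big_nat; apply: eq_bigr => j /andP[j0 jn].
rewrite digamma_dct ?j0// -/(cos_csc_sum R n j).
have s0 : 0 < sin (pi * j%:R / n%:R) :> R.
  by rewrite sin_gt0_pi// itv_pi_ratio// j0.
by rewrite lnM ?posrE// /csc lnV ?posrE//; ring.
Qed.
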